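(* Let $n\ge 1$, let $\{b_{ij}:1\le j\le i\le n\}$ be given real scalars, and let $\{g_{ij}:1\le j\le i\le n\}$ be i.i.d. $N(0,1)$ random variables. Let $X$ be the $n\times n$ symmetric random matrix with $X_{ij}=X_{ji}=g_{ij}b_{ij}$ for $i\ge j$. Set $b_{ij}:=b_{ji}$ for $i<j$ and define $$\sigma:=\max_i\sqrt{\sum_j b_{ij}^2},\qquad \sigma_*:=\max_{ij}|b_{ij}|.$$ Then for any $0<\varepsilon\le 1/2$, $$\mathbb{E}\|X\|\le (1+\varepsilon)\Big\{2\sigma+\frac{6}{\sqrt{\log(1+\varepsilon)}}\,\sigma_*\sqrt{\log n}\Big\}.$$
   Context: $\|\cdot\|$ denotes the spectral (operator) norm and $\log$ the natural logarithm. *)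

(* Defs.v *)
From HB Require Import structures.
From mathcomp Require Import all_boot all_order all_algebra.
From mathcomp Require Import all_classical all_reals all_analysis.
Set Implicit Arguments. Unset Strict Implicit. Unset Printing Implicit Defensive.
Import Order.TTheory GRing.Theory Num.Theory.
Local Open Scope classical_set_scope.
Local Open Scope ring_scope.

Definition vnorm2 {R : realType} {n : nat} (v : 'cV[R]_n) : R :=
  Num.sqrt (\sum_(i < n) v i 0 ^+ 2).

Definition opnorm {R : realType} {n : nat} (A : 'M[R]_n) : R :=
  sup [set vnorm2 (A *m v) | v in [set v : 'cV[R]_n | vnorm2 v = 1]].

(* symmetric extension: b_{ij} := b_{ji} for i < j; only the entries with j <= i
   (lower triangle incl. diagonal) of b are used *)
Definition symext {R : Type} {n : nat} (b : 'I_n -> 'I_n -> R) (i j : 'I_n) : R :=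
  if (j <= i)%N then b i j else b j i.

Definition randmx {T : Type} {R : realType} {n : nat}
  (b : 'I_n -> 'I_n -> R) (g : 'I_n -> 'I_n -> T -> R) (w : T) : 'M[R]_n :=
  \matrix_(i, j) (symext b i j * symext (fun k l => g k l w) i j).

Definition sigma_row {R : realType} {n : nat} (b : 'I_n -> 'I_n -> R) : R :=
  \big[Num.max/0]_(i < n) Num.sqrt (\sum_(j < n) symext b i j ^+ 2).

Definition sigma_star {R : realType} {n : nat} (b : 'I_n -> 'I_n -> R) : R :=
  \big[Num.max/0]_(i < n) \big[Num.max/0]_(j < n) `|symext b i j|.

Definition iid_std_gaussian {d} {T : measurableType d} {R : realType}
  (P : probability T R) (n : nat) (g : 'I_n -> 'I_n -> T -> R) : Prop :=
  [/\ (forall i j : 'I_n, (j <= i)%N -> measurable_fun setT (g i j)),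
      (forall i j : 'I_n, (j <= i)%N -> forall A : set R, measurable A ->
          P (g i j @^-1` A) = normal_prob 0 1 A) &
      (forall A : 'I_n -> 'I_n -> set R, (forall i j, measurable (A i j)) ->
          P [set w | forall i j : 'I_n, (j <= i)%N -> A i j (g i j w)] =
          (\prod_(i < n) \prod_(j < n | (j <= i)%N) P (g i j @^-1` A i j))%E)].

(* Main.v *)
(* The theorem follows from the moment bound
   E (X^(2p))_uu <= (2c)^(2p) for every u, whenever c^2 >= sigma^2 + 4 p sigma_*^2,
   by taking p of order log n / (2 log (1 + eps)), so that n^(1/2p) <= 1 + eps.
   To get the moment bound, expand X^(2p) along walks and the Gaussian products in
   Hermite polynomials: by x He_k = He_(k+1) + k He_(k-1), a step of the walk along
   an edge either opens a copy of this edge (weight b_vw^2) or closes one of its open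
   copies, and only walks that close everything contribute to the expectation.
   Let delta_x be the number of open half edges at the vertex x, plus one if the
   walker is at x.  Weigh a state by the product over x of
   (delta_x - 1) (delta_x - 3) ...  The weight lost when an edge is closed at v pays
   exactly for the choice of that edge, and an opening step costs
   sum_w b_vw^2 (delta_w + 1) <= sigma^2 + sigma_*^2 (2 E + 1), where E is the
   number of open edges.  So each opening contributes a factor at most c^2, and the
   choice between opening and closing contributes 2^(2p). *)
Require Import Defs.
From HB Require Import structures.
From mathcomp Require Import all_boot all_order all_algebra.
From mathcomp Require Import all_classical all_reals all_analysis.
From mathcomp Require Import measurable_realfun.
From mathcomp Require Import ring lra zify.
Import Order.TTheory GRing.Theory Num.Theory.
Import numFieldNormedType.Exports.
Local Open Scope classical_set_scope.
Local Open Scope ring_scope.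
Set Implicit Arguments. Unset Strict Implicit. Unset Printing Implicit Defensive.

(** * Walks, open edges and the potential *)

Section walk_expansion.
Variables (R : realType) (n : nat).
Implicit Types (m : {ffun 'I_n * 'I_n -> nat}) (e : 'I_n * 'I_n) (u v w x : 'I_n).

(** Representative of an unordered pair, larger index first, so that it names a lower-triangular
    variable. A function [m] records how many copies of each edge are open. *)
Definition edge v w : 'I_n * 'I_n := if (w <= v)%N then (v, w) else (w, v).

Definition incm e m := [ffun f => (m f + (f == e))%N].
(** The subtraction is truncated; where [m e = 0] the factor [m e] in front of a closing step
    vanishes anyway. *)
Definition decm e m := [ffun f => (m f - (f == e))%N].

Lemma decmK e m : (0 < m e)%N -> incm e (decm e m) = m.
Proof.
move=> me; apply/ffunP => f; rewrite !ffunE.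
by have [->|_] := eqVneq f e; rewrite ?subnK// subn0 addn0.
Qed.

(** Open half edges at [x]: a loop counts twice. *)
Definition deg m x := (\sum_e m e * ((x == e.1) + (x == e.2)))%N.
Definition nedges m := (\sum_e m e)%N.

Lemma nedges_inc e m : nedges (incm e m) = (nedges m).+1.
Proof.
rewrite /nedges; under eq_bigr do rewrite ffunE.
rewrite big_split /= -addn1; congr addn.
by rewrite (bigD1 e) //= eqxx big1 ?addn0 // => f /negbTE ->.
Qed.

Lemma deg_inc e m x : deg (incm e m) x = (deg m x + ((x == e.1) + (x == e.2)))%N.
Proof.
rewrite /deg; under eq_bigr do rewrite ffunE mulnDl.
rewrite big_split /=; congr addn.
by rewrite (bigD1 e) //= eqxx mul1n big1 ?addn0 // => f /negbTE ->.
Qed.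

Lemma sum_deg m : (\sum_x deg m x = (nedges m).*2)%N.
Proof.
rewrite /deg exchange_big /= -mul2n big_distrr /=; apply: eq_bigr => e _.
rewrite -big_distrr /= mulnC; congr muln; rewrite big_split /=.
have E y : (\sum_(x : 'I_n) (x == y) = 1)%N.
  by rewrite (bigD1 y) //= eqxx big1 // => x /negbTE ->.
by rewrite !E.
Qed.

Lemma edge_ends v w x :
  ((x == (edge v w).1) + (x == (edge v w).2) = (x == v) + (x == w))%N.
Proof. by rewrite /edge; case: ifP => _ //=; rewrite addnC. Qed.

Lemma edge_inj v : injective (edge v).
Proof.
by move=> w w'; rewrite /edge; do 2 case: leqP => ?; case; do ?move=> ->.
Qed.

(** Distinct [w] give distinct edges at [v], and each open copy of such an edge puts at least one
    half edge at [v]. *)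
Lemma sum_edge_deg m v : (\sum_w m (edge v w) <= deg m v)%N.
Proof.
rewrite /deg -(big_imset (fun e => m e)) /=; last by move=> ? ? _ _; apply: edge_inj.
rewrite [leqRHS](bigID (mem [set edge v w | w in 'I_n]%SET)) /=.
apply: leq_trans (leq_addr _ _).
apply: leq_sum => e /imsetP[w _ ->].
by rewrite edge_ends eqxx /= leq_pmulr.
Qed.

(** The double factorial (k-1)!! = (k-1)(k-3)..., equal to 1 for k = 0 and k = 1. *)
Fixpoint hfact k : nat := if k is (k'.+1 as k1).+1 then (k1 * hfact k')%N else 1%N.

Lemma hfactSS k : hfact k.+2 = (k.+1 * hfact k)%N.
Proof. by []. Qed.

(* The walker's position counts as a half edge; with this convention an opening
   step into [w] raises only the degree of [w], and a closing step out of [v]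
   lowers only the degree of [v], each by two. *)
Definition pdeg m v x := (deg m x + (x == v))%N.
Definition potential m v := (\prod_x hfact (pdeg m v x))%N.

Lemma potential_shift (d d' : 'I_n -> nat) w :
  (forall x, d' x = (d x + (x == w).*2)%N) ->
  (\prod_x hfact (d' x) = (d w).+1 * \prod_x hfact (d x))%N.
Proof.
move=> dd'; rewrite (bigD1 w) //= [in RHS](bigD1 w) //= mulnA; congr muln.
  by rewrite dd' eqxx addn2 hfactSS.
by apply: eq_bigr => x /negbTE xw; rewrite dd' xw addn0.
Qed.

Lemma potential_open m v w :
  potential (incm (edge v w) m) w = ((pdeg m v w).+1 * potential m v)%N.
Proof.
apply: potential_shift => x; rewrite /pdeg deg_inc edge_ends; lia.
Qed.

(** Closing from [v] to [w] is the reverse of opening from [w] to [v], so the factor lost is the one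
    gained there, [(pdeg m' w v).+1 = deg m v]. *)
Lemma potential_close m v w : (0 < m (edge v w))%N ->
  potential m v = (deg m v * potential (decm (edge v w) m) w)%N.
Proof.
move=> mvw; set m' := decm _ _.
have mE : m = incm (edge v w) m' by rewrite decmK.
have -> : deg m v = (pdeg m' w v).+1.
  by rewrite /pdeg mE deg_inc edge_ends eqxx; lia.
by apply: potential_shift => x; rewrite /pdeg mE deg_inc edge_ends; lia.
Qed.

(** Weighted sum over walks of [t] steps from [v] to [u] that start with the copies [m] open and end
    with none. The whole weight [B] of an edge is paid at its opening; a closing counts the copies
    available. *)
Fixpoint wick (B : 'I_n -> 'I_n -> R) u t m v : R :=
  if t is t'.+1 then
    \sum_w (B v w * wick B u t' (incm (edge v w) m) w
            + (m (edge v w))%:R * wick B u t' (decm (edge v w) m) w)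
  else ((v == u) && (m == [ffun=> 0%N]))%:R.

(** Induction on [t]. Of the bound for [t.+1], namely [2 * c * Q], one half pays for openings and
    the other for closings. The power of [c] on the left spreads the cost [c ^+ 2] of an opening
    evenly over the opening and its closing. *)
Lemma wick_le (B : 'I_n -> 'I_n -> R) u N (S K c : R) t m v :
  (forall v w, 0 <= B v w) -> (forall v w, B v w <= K) ->
  (forall v, \sum_w B v w <= S) -> 0 < c -> S + K * N.*2%:R <= c ^+ 2 ->
  (nedges m + t <= N)%N ->
  wick B u t m v * c ^+ nedges m <= (2 * c) ^+ t * (potential m v)%:R.
Proof.
move=> B0 BK BS c0 SKc; elim: t m v => [|t IH] m v tN.
  rewrite /= expr0 mul1r.
  have p1 : 1 <= (potential m v)%:R :> R.
    rewrite ler1n prodn_gt0 // => x; elim/ltn_ind: (pdeg _ _ _) => -[|[|k]] // H.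
    by rewrite hfactSS muln_gt0 /= H.
  have [/andP[_ /eqP m0]|_] := boolP (_ && _); last by rewrite mul0r (le_trans _ p1).
  by rewrite mul1r /nedges big1 ?expr0 // => e _; rewrite m0 ffunE.
rewrite /= big_split /= mulrDl.
set Q := (2 * c) ^+ t * (potential m v)%:R.
have -> : (2 * c) ^+ t.+1 * (potential m v)%:R = c * Q + c * Q.
  by rewrite exprS /Q; ring.
have Q0 : 0 <= Q by rewrite mulr_ge0 // exprn_ge0 // mulr_ge0 // ltW.
have K0 : 0 <= K by apply: le_trans (B0 v v) (BK v v).
apply: lerD.
  (* Multiplying by [c] produces the exponent [nedges m + 1] that the induction hypothesis needs
     after an opening. *)
  rewrite -(ler_pM2r c0) -mulrA -exprSr mulr_suml.
  apply: (@le_trans _ _ (\sum_w B v w * (pdeg m v w).+1%:R * Q)).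
    apply: ler_sum => w _; rewrite -[leLHS]mulrA -[leRHS]mulrA ler_wpM2l //.
    have := IH (incm (edge v w) m) w; rewrite nedges_inc addSnnS => /(_ tN).
    by rewrite potential_open natrM mulrCA.
  rewrite -mulr_suml mulrAC ler_wpM2r // -expr2; apply: le_trans SKc.
  (* The 1 in [pdeg + 1] yields at most [S]. The rest yields at most [K] times the total degree
     [2 * nedges m + 1], which is below [2 * N] because a step is still to be made. *)
  under eq_bigr do rewrite -natr1 mulrDr mulr1.
  rewrite big_split /= addrC lerD //.
  apply: (@le_trans _ _ (\sum_w K * (pdeg m v w)%:R)).
    by apply: ler_sum => w _; rewrite ler_wpM2r.
  rewrite -mulr_sumr -natr_sum ler_wpM2l // ler_nat /pdeg big_split /= sum_deg.
  rewrite (bigD1 v) //= eqxx big1 ?addn0; last by move=> w /negbTE ->.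
  lia.
rewrite mulr_suml.
have [dv0|dv0] := posnP (deg m v).
  rewrite big1; first by rewrite mulr_ge0 // ltW.
  move=> w _; suff -> : m (edge v w) = 0%N by rewrite !mul0r.
  have := sum_edge_deg m v; rewrite dv0 leqn0 sum_nat_eq0 => /forallP /(_ w) /=.
  by move/eqP.
(* Closing towards [w] is charged the share [m (edge v w) / deg m v] of [c * Q]; by [sum_edge_deg]
   the shares add up to at most 1. *)
apply: (@le_trans _ _ (\sum_w c * Q * ((m (edge v w))%:R / (deg m v)%:R))).
  apply: ler_sum => w _; have [->|mvw] := posnP (m (edge v w)).
    by rewrite !mul0r mulr0.
  rewrite -mulrA [leRHS]mulrCA ler_wpM2l //.
  set m' := decm _ _; have mE : m = incm (edge v w) m' by rewrite decmK.
  have Em : nedges m = (nedges m').+1 by rewrite {1}mE nedges_inc.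
  have := IH m' w; rewrite Em in tN *; move=> /(_ ltac:(lia)) H.
  rewrite /Q (potential_close mvw) -/m' natrM exprS mulrCA.
  rewrite -!mulrA ler_wpM2l ?(ltW c0) //; apply: le_trans H _.
  rewrite le_eqVlt; apply/orP; left; apply/eqP; field.
  by rewrite pnatr_eq0 -lt0n.
have cQ0 : 0 <= c * Q by apply: mulr_ge0 => //; exact: ltW.
rewrite -mulr_sumr ler_piMr //.

by rewrite -mulr_suml -natr_sum ler_pdivrMr ?ltr0n // mul1r ler_nat sum_edge_deg.
Qed.

End walk_expansion.

(** * Operator norm and traces of powers *)

Section opnorm_trace.
Variables (R : realType) (n : nat).
Implicit Types (A X : 'M[R]_n) (v w : 'cV[R]_n).

Let dot v w : R := \sum_i v i 0 * w i 0.

(** Lagrange's identity: the defect is half the double sum of the squares of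
    [x i * y j - x j * y i]. *)
Lemma sum_CauchySchwarz (I : finType) (x y : I -> R) :
  (\sum_i x i * y i) ^+ 2 <= (\sum_i x i ^+ 2) * (\sum_i y i ^+ 2).
Proof.
have : 0 <= \sum_i \sum_j (x i * y j - x j * y i) ^+ 2.
  by do 2 (apply: sumr_ge0 => ? _); exact: sqr_ge0.
suff -> : \sum_i \sum_j (x i * y j - x j * y i) ^+ 2 =
  2 * ((\sum_i x i ^+ 2) * (\sum_i y i ^+ 2) - (\sum_i x i * y i) ^+ 2).
  by rewrite pmulr_rge0 // subr_ge0.
have E1 : (\sum_i x i ^+ 2) * (\sum_i y i ^+ 2) = \sum_i \sum_j x i ^+ 2 * y j ^+ 2.
  by rewrite mulr_suml; apply: eq_bigr => i _; rewrite mulr_sumr.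
have E1' : (\sum_i x i ^+ 2) * (\sum_i y i ^+ 2) = \sum_i \sum_j x j ^+ 2 * y i ^+ 2.
  by rewrite E1 exchange_big.
have E2 : (\sum_i x i * y i) ^+ 2 = \sum_i \sum_j x i * y i * (x j * y j).
  by rewrite expr2 mulr_suml; apply: eq_bigr => i _; rewrite mulr_sumr.
rewrite mulrBr mulr_natl mulr2n {1}E1 E1' E2 mulr_sumr.
rewrite -big_split -sumrB /=; apply: eq_bigr => i _.
by rewrite mulr_sumr -big_split -sumrB /=; apply: eq_bigr => j _; ring.
Qed.

Let dot_sym X v w : X^T = X -> dot (X *m v) w = dot v (X *m w).
Proof.
move=> XT; rewrite /dot; under eq_bigr do rewrite mxE mulr_suml.
rewrite exchange_big /=; apply: eq_bigr => i _; rewrite mxE mulr_sumr.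
by apply: eq_bigr => j _; rewrite -{1}XT mxE mulrA (mulrC (X i j)).
Qed.

Lemma trace_even_pow X p : X^T = X ->
  \tr (X ^+ (p + p)) = \sum_i \sum_j (X ^+ p) i j ^+ 2.
Proof.
move=> XT; rewrite exprD /mxtrace; apply: eq_bigr => i _.
rewrite mxE; apply: eq_bigr => j _; rewrite expr2; congr (_ * _).
have XpT : (X ^+ p)^T = X ^+ p.
  elim: p => [|p IH]; first by rewrite expr0 trmx1.
  by transitivity (X ^+ p *m X); [rewrite exprS trmx_mul IH XT|rewrite exprSr].
by rewrite -{1}XpT mxE.
Qed.

(** No diagonalization: a_k = |X^k v|^2 is log-convex by symmetry and Cauchy-Schwarz, and a_0 = 1,
    so a_1^p <= a_p. Finally a_p is at most the squared Frobenius norm of X^p, which is the trace of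
    X^(2p). *)
Lemma symmx_pow_norm X v p : X^T = X -> \sum_i v i 0 ^+ 2 = 1 ->
  (\sum_i (X *m v) i 0 ^+ 2) ^+ p <= \tr (X ^+ (p + p)).
Proof.
move=> XT v1.
pose y k := iter k (mulmx X) v; pose a k := dot (y k) (y k).
have aE k : a k = \sum_i (y k) i 0 ^+ 2 by apply: eq_bigr => i _; rewrite expr2.
have a_ge0 k : 0 <= a k by rewrite aE; apply: sumr_ge0 => i _; rewrite sqr_ge0.
have a_logconvex k : a k.+1 ^+ 2 <= a k * a k.+2.
  by rewrite {1}/a /= dot_sym // !aE; exact: sum_CauchySchwarz.
have a0 : a 0%N = 1 by rewrite aE.
(* The ratios a_(k+1) / a_k are nondecreasing and start at a_1. *)
have a_step k : a 1%N * a k <= a k.+1.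
  elim: k => [|k IH]; first by rewrite a0 mulr1.
  have [ak0|ak0] := eqVneq (a k.+1) 0; first by rewrite ak0 mulr0.
  have akp : 0 < a k.+1 by rewrite lt_neqAle eq_sym ak0 a_ge0.
  rewrite -(ler_pM2r akp) -mulrA -expr2.
  apply: le_trans (ler_wpM2l (a_ge0 1%N) (a_logconvex k)) _.
  by rewrite mulrA mulrC; apply: ler_wpM2l.
have -> : \sum_i (X *m v) i 0 ^+ 2 = a 1%N by rewrite aE.
apply: (@le_trans _ _ (a p)).
  elim: (p) => [|q IH]; first by rewrite expr0 a0.
  by rewrite exprS; apply: le_trans (a_step q); apply: ler_wpM2l.
have yE : y p = X ^+ p *m v.
  by elim: p => [|p IH]; rewrite ?expr0 ?mul1mx //= IH exprS mulmxA.
rewrite trace_even_pow // aE; apply: ler_sum => i _; rewrite yE.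
rewrite mxE; apply: le_trans (sum_CauchySchwarz _ _) _.
by rewrite v1 mulr1.
Qed.

Lemma Bernoulli_pow (z : R) q : 0 <= z -> 1 + q%:R * (z - 1) <= z ^+ q.
Proof.
move=> z0; elim: q => [|q IH]; first by rewrite expr0 mul0r addr0.
rewrite exprS; apply: le_trans (ler_wpM2l z0 IH).
rewrite -natr1 -subr_ge0.
have -> : z * (1 + q%:R * (z - 1)) - (1 + (q%:R + 1) * (z - 1)) = q%:R * (z - 1) ^+ 2.
  by ring.
by rewrite mulr_ge0 // sqr_ge0.
Qed.

Lemma opnorm_ge0 A : 0 <= opnorm A.
Proof.
rewrite /opnorm; set S := (X in sup X).
(* By convention [sup] is 0 on an empty or unbounded set. *)
have [S0|/set0P[x Sx]] := eqVneq S set0; first by rewrite S0 sup0.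
have [uS|nuS] := pselect (has_ubound S); last first.
  by rewrite sup_out // => -[_ /nuS].
apply: (@le_trans _ _ x); last by apply: ub_le_sup.
by case: Sx => v _ <-; exact: sqrtr_ge0.
Qed.

(* The convex function [x ^ 2p] lies above its tangent at [a]. *)
Lemma opnorm_le_trace X p (a : R) : (0 < n)%N -> (0 < p)%N -> 0 < a -> X^T = X ->
  opnorm X <= a / (p + p)%:R * (\tr (X ^+ (p + p)) / a ^+ (p + p) - 1) + a.
Proof.
move=> n0 p0 a0 XT; apply: ge_sup => [|_ [v /= v1 <-]].
  exists (vnorm2 (X *m delta_mx (Ordinal n0) 0)), (delta_mx (Ordinal n0) 0) => //=.
  rewrite /vnorm2 (bigD1 (Ordinal n0)) //= big1 ?addr0; last first.
    by move=> i /negbTE h; rewrite mxE h expr0n.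
  by rewrite mxE !eqxx expr1n sqrtr1.
have v1' : \sum_i v i 0 ^+ 2 = 1.
  rewrite -[RHS](expr1n _ 2) -v1 sqr_sqrtr //.
  by apply: sumr_ge0 => i _; rewrite sqr_ge0.
have := symmx_pow_norm p XT v1'.
set N := vnorm2 _.
have -> : (\sum_i (X *m v) i 0 ^+ 2) ^+ p = N ^+ (p + p).
  rewrite addnn -mul2n exprM sqr_sqrtr //.
  by apply: sumr_ge0 => i _; rewrite sqr_ge0.
move=> Ntr; have q0 : 0 < (p + p)%:R :> R by rewrite ltr0n addn_gt0 p0.
have := Bernoulli_pow (p + p) (divr_ge0 (sqrtr_ge0 _ : 0 <= N) (ltW a0)).
rewrite expr_div_n; set q := (p + p)%N => H.
have {}H : 1 + q%:R * (N / a - 1) <= \tr (X ^+ q) / a ^+ q.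
  by apply: le_trans H _; rewrite ler_pM2r // invr_gt0 exprn_gt0.
rewrite -lerBlDr -mulrA mulrC -ler_pdivrMr // ler_pdivlMl //.
rewrite lerBrDl; apply: le_trans H.
rewrite lerD2l le_eqVlt; apply/orP; left; apply/eqP; field.
by rewrite gt_eqF.
Qed.

End opnorm_trace.

(** * Independence *)

Section weighted_law.
Context d1 d2 (T : measurableType d1) (U : measurableType d2) (R : realType).
Variables (P : {measure set T -> \bar R}) (nu : {measure set U -> \bar R}).
Import HBNNSimple.

(** The hypothesis is the claim for indicators; simple functions follow by linearity, and general
    [f] by monotone convergence. *)
Lemma ge0_integral_weighted_law (X : T -> U) (Y : T -> R) (c : R) (f : U -> R) :
  measurable_fun setT X -> measurable_fun setT Y -> (forall w, 0 <= Y w) -> 0 <= c ->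
  (forall A, measurable A ->
     (\int[P]_w (Y w * \1_A (X w))%:E = c%:E * nu A)%E) ->
  measurable_fun setT f -> (forall x, 0 <= f x) ->
  (\int[P]_w (Y w * f (X w))%:E = c%:E * \int[nu]_x (f x)%:E)%E.
Proof.
move=> mX mY Y0 c0 HA mf f0.
have mEf := (measurable_EFinP setT f).2 mf.
pose h := nnsfun_approx measurableT mEf.
have hf x : (EFin \o h k) x @[k --> \oo] --> (f x)%:E.
  by apply: cvg_nnsfun_approx => // y _; rewrite lee_fin.
have ndh x a b : (a <= b)%N -> h a x <= h b x.
  by move=> ab; exact/lefP/nd_nnsfun_approx.
have -> : (\int[nu]_x (f x)%:E = limn (fun k => \int[nu]_x (EFin \o h k) x))%E.
  rewrite -monotone_convergence//.
  - by apply: eq_integral => x _; apply/esym/cvg_lim => //; exact: hf.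
  - by move=> k; exact/measurable_EFinP/measurable_funP.
  - by move=> k x _; rewrite lee_fin.
  - by move=> x _ a b ab; rewrite lee_fin; exact: ndh.
rewrite -limeMl//; last first.
  apply: ereal_nondecreasing_is_cvgn => a b ab; apply: ge0_le_integral => //.
  - by move=> x _; rewrite lee_fin.
  - by apply/measurable_EFinP/measurable_funP.
  - by apply/measurable_EFinP/measurable_funP.
  - by move=> x _; rewrite lee_fin; exact: ndh.
have mYh k : measurable_fun setT (fun w => (Y w * h k (X w))%:E).
  by apply/measurable_EFinP/measurable_funM => //; apply: measurableT_comp.
transitivity (limn (fun k => \int[P]_w (Y w * h k (X w))%:E))%E.
  rewrite -monotone_convergence//.
  - apply: eq_integral => w _; apply/esym/cvg_lim => //.
    under eq_fun do rewrite EFinM.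
    by rewrite EFinM; apply: cvgeZl => //; exact: hf.
  - by move=> k w _; rewrite lee_fin mulr_ge0.
  - by move=> w _ a b ab; rewrite lee_fin ler_wpM2l//; exact: ndh.
congr (limn _); apply/funext => k.
transitivity (\int[P]_w (\sum_(y \in range (h k))
    (Y w * (y * \1_(h k @^-1` [set y]) (X w)))%:E))%E.
  apply: eq_integral => w _; rewrite fsumEFin// [in LHS]fimfunE.
  by rewrite mulr_fsumr.
have my y : measurable (h k @^-1` [set y]) by [].
have mI y : measurable_fun setT (fun w => \1_(h k @^-1` [set y]) (X w) : R).
  by apply: measurableT_comp.
have rh y : range (h k) y -> 0 <= y by case=> x _ <-.
have ind0 y x : 0 <= y * \1_(h k @^-1` [set y]) x :> R.
  by have := nnfun_muleindic_ge0 (h k) y x; rewrite lee_fin.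
rewrite ge0_integral_fsum//; last 2 first.
- by move=> y; apply/measurable_EFinP; do 2 apply: measurable_funM => //.
- by move=> y w _; rewrite lee_fin mulr_ge0.
rewrite integralT_nnsfun sintegralE.
have cfs : (c%:E * \sum_(x \in range (h k)) (x%:E * nu (h k @^-1` [set x])) =
   \sum_(x \in range (h k)) (c%:E * (x%:E * nu (h k @^-1` [set x]))))%E.
  rewrite ge0_mule_fsumr// => y; have [<-|yh] := eqVneq (nu set0) (nu (h k @^-1` [set y])).
    by rewrite measure0 mule0.
  have [y0|y0] := leP 0 y; first by rewrite mule_ge0 ?lee_fin.
  by rewrite preimage_nnfun0 ?measure0 ?mule0.
rewrite cfs; apply: eq_fsbigr => y /[!inE] /rh y0.
under eq_integral do rewrite mulrCA EFinM.
rewrite ge0_integralZl//.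
- by rewrite HA// muleCA.
- by apply/measurable_EFinP/measurable_funM.
- by move=> w _; rewrite lee_fin mulr_ge0.
Qed.

End weighted_law.

Definition polymean {R : realType} (nu : set R -> \bar R) (q : {poly R}) : R :=
  fine (\int[nu]_x (q.[x])%:E)%E.

Section independence.
Context d (T : measurableType d) (R : realType) (I : finType).
Variables (P : probability T R) (nu : probability R R).
Variables (D : pred I) (X : I -> T -> R).
Hypothesis mX : forall i, D i -> measurable_fun setT (X i).
Hypothesis indepX : forall A : I -> set R, (forall i, measurable (A i)) ->
  P [set w | forall i, D i -> A i (X i w)] = (\prod_(i | D i) nu (A i))%E.

(** Induction on the list [S] of indices whose factor may be arbitrary, the other factors being
    indicators. For empty [S] this is [indepX]. One more index is freed by the weighted law, with
    the product of the remaining factors as weight. *)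
Let integral_prod_ge0_seq (S : seq I) (f : I -> R -> R) (c : I -> R) :
  (forall i, measurable_fun setT (f i)) -> (forall i x, 0 <= f i x) ->
  (forall i, \int[nu]_x (f i x)%:E = (c i)%:E)%E ->
  (forall i, D i -> i \notin S -> exists2 A, measurable A & f i = \1_A) ->
  (\int[P]_w (\prod_(i | D i) f i (X i w))%:E = (\prod_(i | D i) c i)%:E)%E.
Proof.
elim: S f c => [|i0 S IH] f c mf f0 fc fS.
  have /choice[A HA] : forall i, exists A, D i -> measurable A /\ f i = \1_A.
    move=> i; have [Di|_] := boolP (D i); last by exists set0.
    by have [A mA fA] := fS i Di isT; exists A.
  pose A' i := if D i then A i else setT.
  have mA' i : measurable (A' i).
    by rewrite /A'; case: ifP => // Di; have [] := HA i Di.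
  transitivity (\int[P]_w (\1_[set w | forall i, D i -> A' i (X i w)] w)%:E)%E.
    apply: eq_integral => w _; congr EFin; rewrite indicE.
    have [/set_mem /= H|H] := boolP (w \in _).
      rewrite big1// => i Di; have [_ ->] := HA i Di.
      by rewrite indicE mem_set//; have := H i Di; rewrite /A' Di.
    move/negP: H; rewrite in_setE /= -existsNE => -[i /not_implyP[Di nA]].
    rewrite (bigD1 i)//=; have [_ ->] := HA i Di.
    by rewrite indicE memNset ?mul0r//; move: nA; rewrite /A' Di.
  have mE : measurable [set w | forall i, D i -> A' i (X i w)].
    rewrite (_ : [set _ | _] = \bigcap_(i in [set i | D i]) (X i @^-1` A' i)).
      apply: fin_bigcap_measurable => // i Di.
      by rewrite -[X in measurable X]setTI; exact: mX.
    by apply/seteqP; split => w /= H i; exact: H.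
  transitivity (P [set w | forall i, D i -> A' i (X i w)]).
    by rewrite integral_indic// setIT.
  rewrite indepX// -prodEFin; apply: eq_bigr => i Di.
  have [_ fi] := HA i Di; rewrite -fc fi integral_indic//; last by case: (HA i Di).
  by rewrite setIT /A' Di.
have [Di0|nDi0] := boolP (D i0); last first.
  apply: IH => // i Di iS; apply: fS => //; rewrite inE negb_or iS andbT.
  by apply: contra nDi0 => /eqP <-.
have c0 i : 0 <= c i.
  by rewrite -lee_fin -fc integral_ge0// => x _; rewrite lee_fin.
rewrite (bigD1 i0)//= mulrC EFinM -fc.
under eq_integral do rewrite (bigD1 i0)//= mulrC.
apply: (@ge0_integral_weighted_law _ _ _ _ _ P nu (X i0)
  (fun w => \prod_(i | D i && (i != i0)) f i (X i w))) => //.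
- exact: mX.
- rewrite [X in measurable_fun _ X](_ : _ =
      fun w => \prod_i if D i && (i != i0) then f i (X i w) else 1); last first.
    by apply/funext => w; rewrite big_mkcond.
  apply: measurable_prod => i _; have [/andP[Di _]|_] := boolP (D i && (i != i0)) => //.
  by apply: measurableT_comp => //; exact: mX.
- by move=> w; apply: prodr_ge0.
- by apply: prodr_ge0.
move=> A mA.
(* With an indicator in place of the factor at [i0], the induction hypothesis gives the weighted law
   on sets. *)
pose f' i := if i == i0 then \1_A : R -> R else f i.
pose c' i := if i == i0 then fine (nu A) else c i.
have c'E : \prod_(i | D i) c' i = \prod_(i | D i && (i != i0)) c i * fine (nu A).
  rewrite (bigD1 i0)//= mulrC; congr (_ * _); last by rewrite /c' eqxx.
  by apply: eq_bigr => i /andP[_ /negbTE ii0]; rewrite /c' ii0.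
have := IH f' c'; rewrite c'E EFinM fineK ?fin_num_measure// => <-.
- apply: eq_integral => w _; congr EFin; rewrite [RHS](bigD1 i0)//= mulrC.
  congr (_ * _); first by rewrite /f' eqxx.
  by apply: eq_bigr => i /andP[_ /negbTE ii0]; rewrite /f' ii0.
- by move=> i; rewrite /f'; case: ifP.
- by move=> i x; rewrite /f'; case: ifP.
- move=> i; rewrite /f' /c'; case: ifP => // _.
  by rewrite integral_indic// setIT fineK ?fin_num_measure.
- move=> i Di iS; rewrite /f'; case: ifPn => [_|ii0]; first by exists A.
  by apply: fS; rewrite // inE negb_or ii0.
Qed.

Hypothesis nu_poly : forall q : {poly R}, nu.-integrable setT (fun x => (q.[x])%:E).

Lemma polymeanE q : (\int[nu]_x (q.[x])%:E = (polymean nu q)%:E)%E.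
Proof. by rewrite fineK//; exact: integrable_fin_num. Qed.

Lemma polymeanB p q : polymean nu (p - q) = polymean nu p - polymean nu q.
Proof.
apply: EFin_inj; rewrite EFinB -!polymeanE -integralB//.
by apply: eq_integral => x _; rewrite hornerD hornerN EFinB.
Qed.

(** Writes any polynomial as a difference of two nonnegative ones, which reduces signed integrands
    to nonnegative ones. *)
Lemma poly_diff_squares (q : {poly R}) :
  q = (2^-1 *: (q + 1)) ^+ 2 - (2^-1 *: (q - 1)) ^+ 2.
Proof.
rewrite !exprZn -scalerBr.
have -> : (q + 1) ^+ 2 - (q - 1) ^+ 2 = 4%:R *: q.
  by rewrite scaler_nat; ring.
by rewrite scalerA (_ : _ * _ = 1) ?scale1r//; field.
Qed.

(** Induction on the list [S] of indices whose polynomial may change sign; each is split into two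
    squares, and both sides are linear in that factor. *)
Lemma integral_prod_poly (f : I -> {poly R}) :
  P.-integrable setT (fun w => (\prod_(i | D i) (f i).[X i w])%:E) /\
  (\int[P]_w (\prod_(i | D i) (f i).[X i w])%:E = (\prod_(i | D i) polymean nu (f i))%:E)%E.
Proof.
have mpoly (q : {poly R}) : measurable_fun setT (horner q).
  by apply: continuous_measurable_fun; exact: continuous_horner.
have mprod (h : I -> {poly R}) : measurable_fun setT (fun w => \prod_(i | D i) (h i).[X i w]).
  rewrite [X in measurable_fun _ X](_ : _ =
      fun w => \prod_i if D i then (h i).[X i w] else 1); last first.
    by apply/funext => w; rewrite big_mkcond.
  apply: measurable_prod => i _; have [Di|_] := boolP (D i) => //.
  by apply: (measurableT_comp (mpoly _)); exact: mX.
suff H (S : seq I) (h : I -> {poly R}) :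
    (forall i, D i -> i \notin S -> forall x, 0 <= (h i).[x]) ->
    P.-integrable setT (fun w => (\prod_(i | D i) (h i).[X i w])%:E) /\
    (\int[P]_w (\prod_(i | D i) (h i).[X i w])%:E = (\prod_(i | D i) polymean nu (h i))%:E)%E.
  by apply: (H (enum I)) => i _; rewrite mem_enum.
elim: S h => [|i0 S IH] h hS.
  (* Outside [D] the polynomial is set to 1, since the nonnegative case asks for a sign at every
     index. *)
  pose h' i := if D i then h i else 1.
  have h'0 i x : 0 <= (h' i).[x].
    by rewrite /h'; case: ifP => [Di|_]; [exact: hS|rewrite hornerC].
  have := @integral_prod_ge0_seq (enum I) (fun i => horner (h' i)) (fun i => polymean nu (h' i)).
  have -> : \prod_(i | D i) polymean nu (h' i) = \prod_(i | D i) polymean nu (h i).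
    by apply: eq_bigr => i Di; rewrite /h' Di.
  have -> : (fun w => (\prod_(i | D i) (h' i).[X i w])%:E) =
            (fun w => (\prod_(i | D i) (h i).[X i w])%:E).
    by apply/funext => w; congr EFin; apply: eq_bigr => i Di; rewrite /h' Di.
  move=> H; have {}H := H (fun i => mpoly _) h'0 (fun i => polymeanE _).
  rewrite H; last by move=> i _; rewrite mem_enum.
  split=> //; apply/integrableP; split; first exact/measurable_EFinP.
  under eq_integral => w _.
    rewrite gee0_abs; last first.
      by rewrite lee_fin prodr_ge0// => i Di; exact: hS.
    over.
  by rewrite H ?ltry// => i _; rewrite mem_enum.
have [Di0|nDi0] := boolP (D i0); last first.
  apply: IH => i Di iS; apply: hS => //; rewrite inE negb_or iS andbT.
  by apply: contra nDi0 => /eqP <-.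
pose u (q : {poly R}) i := if i == i0 then q else h i.
have uE q w : \prod_(i | D i) (u q i).[X i w] =
    q.[X i0 w] * \prod_(i | D i && (i != i0)) (h i).[X i w].
  rewrite (bigD1 i0)//=; congr (_ * _); first by rewrite /u eqxx.
  by apply: eq_bigr => i /andP[_ /negbTE ii0]; rewrite /u ii0.
have uL q : \prod_(i | D i) polymean nu (u q i) =
    polymean nu q * \prod_(i | D i && (i != i0)) polymean nu (h i).
  rewrite (bigD1 i0)//=; congr (_ * _); first by rewrite /u eqxx.
  by apply: eq_bigr => i /andP[_ /negbTE ii0]; rewrite /u ii0.
have IHu q : (forall x, 0 <= q.[x]) -> P.-integrable setT (fun w => (\prod_(i | D i) (u q i).[X i w])%:E) /\
    (\int[P]_w (\prod_(i | D i) (u q i).[X i w])%:E = (\prod_(i | D i) polymean nu (u q i))%:E)%E.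
  move=> q0; apply: IH => i Di iS x; rewrite /u; case: ifPn => // ii0.
  by apply: hS; rewrite // inE negb_or ii0.
pose q1 : {poly R} := (2^-1 *: (h i0 + 1)) ^+ 2; pose q2 : {poly R} := (2^-1 *: (h i0 - 1)) ^+ 2.
have hq : h i0 = q1 - q2 by exact: poly_diff_squares.
have [|i1 e1] := IHu q1; first by move=> x; rewrite horner_exp sqr_ge0.
have [|i2 e2] := IHu q2; first by move=> x; rewrite horner_exp sqr_ge0.
have hE w : \prod_(i | D i) (h i).[X i w] =
    \prod_(i | D i) (u q1 i).[X i w] - \prod_(i | D i) (u q2 i).[X i w].
  by rewrite !uE -mulrBl -hornerN -hornerD -hq (bigD1 i0).
have -> : (fun w => (\prod_(i | D i) (h i).[X i w])%:E) =
  ((fun w => (\prod_(i | D i) (u q1 i).[X i w])%:E) \-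
   (fun w => (\prod_(i | D i) (u q2 i).[X i w])%:E))%E.
  by apply/funext => w; rewrite hE EFinB.
split; first exact: integrableB.
rewrite integralB// e1 e2 -EFinB !uL -mulrBl -polymeanB -hq.
by rewrite [in RHS](bigD1 i0).
Qed.

End independence.

(** * Gaussian moments *)

Section gaussian_moments.
Variable R : realType.
Local Notation mu := (@lebesgue_measure R).
Local Notation phi := (normal_pdf (0 : R) 1).

Let phiE x : phi x = normal_peak 1 * expR (- (x ^+ 2 / 2)).
Proof.
rewrite normal_pdfE ?oner_eq0// /normal_fun subr0 expr1n.
by congr (_ * expR _); rewrite mulNr.
Qed.

(** With y = x^2 / (8(k+1)), y^k <= exp(y)^k <= exp((k+1) y). Taking k+1 instead of k keeps the
    denominator nonzero at k = 0. *)
Lemma expR_pow_ge (x : R) k : x ^+ k.*2 <= (8 * k.+1%:R) ^+ k * expR (x ^+ 2 / 8).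
Proof.
have k0 : 0 < 8 * k.+1%:R :> R by rewrite mulr_gt0.
set y := x ^+ 2 / (8 * k.+1%:R).
have y0 : 0 <= y by rewrite divr_ge0 ?sqr_ge0// ltW.
have -> : x ^+ k.*2 = (8 * k.+1%:R) ^+ k * y ^+ k.
  rewrite -exprMn -mul2n exprM; congr (_ ^+ _); rewrite /y; field.
  by rewrite nat1r pnatr_eq0.
rewrite ler_wpM2l ?exprn_ge0 ?(ltW k0)//.
have -> : x ^+ 2 / 8 = k.+1%:R * y by rewrite /y; field; rewrite nat1r pnatr_eq0.
rewrite expRM_natl; have y1 := expR_ge1Dx y.
apply: (@le_trans _ _ (expR y ^+ k)).
  by rewrite lerXn2r ?nnegrE ?expR_ge0// (le_trans _ y1)// lerDr.
by rewrite exprS ler_peMl ?exprn_ge0 ?expR_ge0// (le_trans _ y1)// lerDl.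
Qed.

Lemma poly_le_expR (q : {poly R}) :
  exists C : R, 0 <= C /\ forall x, `|q.[x]| <= C * expR (x ^+ 2 / 8).
Proof.
exists (\sum_(i < size q) `|q`_i| * (1 + (8 * i.+1%:R) ^+ i)); split.
  by apply: sumr_ge0 => i _; rewrite mulr_ge0// addr_ge0// exprn_ge0// mulr_ge0.
move=> x; rewrite horner_coef; apply: le_trans (ler_norm_sum _ _ _) _.
rewrite mulr_suml; apply: ler_sum => i _; rewrite normrM -mulrA ler_wpM2l//.
rewrite normrX mulrDl mul1r.
apply: (@le_trans _ _ (1 + x ^+ i.*2)).
  rewrite -mul2n exprM -real_normK ?num_real// -exprM mulnC exprM expr2.
  set z := `|x| ^+ i; have := sqr_ge0 (z - 1); have := sqr_ge0 z.
  rewrite !expr2; nra.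
rewrite lerD ?expR_pow_ge// -[leLHS]expR0 ler_expR divr_ge0// sqr_ge0//.
Qed.

(** The polynomial costs exp(x^2/8), and exp(x^2/8 - x^2/2) <= exp(-x^2/8), the profile of the
    normal density of standard deviation 2. This gives an integrable and bounded majorant. *)
Lemma poly_pdf_bound (q : {poly R}) :
  exists C : R, 0 <= C /\ forall x, `|q.[x] * phi x| <= C * normal_pdf 0 2 x.
Proof.
have [C [C0 HC]] := poly_le_expR q.
have two0 : 2 != 0 :> R by rewrite pnatr_eq0.
exists (C * normal_peak 1 / normal_peak 2); split.
  by rewrite divr_ge0 ?mulr_ge0 ?normal_peak_ge0.
move=> x; rewrite normrM (ger0_norm (normal_pdf_ge0 _ _ _)) phiE.
rewrite normal_pdfE// /normal_fun subr0 [leRHS]mulrA divfK; last first.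
  by rewrite gt_eqF// normal_peak_gt0.
rewrite mulrCA [leRHS]mulrAC [leRHS]mulrC ler_wpM2l ?normal_peak_ge0//.
apply: le_trans (ler_wpM2r (expR_ge0 _) (HC x)) _.
rewrite -mulrA -expRD ler_wpM2l// ler_expR -subr_ge0.
have -> : - x ^+ 2 / (2 ^+ 2 *+ 2) - (x ^+ 2 / 8 - x ^+ 2 / 2) = x ^+ 2 / 4.
  by rewrite -mulr_natr; field.
by rewrite divr_ge0 ?sqr_ge0.
Qed.

Let cphi : continuous phi.
Proof. exact: continuous_normal_pdf. Qed.

Let cqphi (q : {poly R}) : continuous (fun x => q.[x] * phi x).
Proof. by move=> x; apply: cvgM; [exact: continuous_horner|exact: cphi]. Qed.

Lemma integrable_poly_pdf (q : {poly R}) :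
  mu.-integrable [set: R] (fun x => (q.[x] * phi x)%:E).
Proof.
have [C [C0 HC]] := poly_pdf_bound q.
have iC : mu.-integrable [set: R] (fun x => (C%:E * (normal_pdf 0 2 x)%:E)%E).
  by apply: integrableZl => //; exact: integrable_normal_pdf.
apply: (le_integrable measurableT _ _ iC).
- apply/measurable_EFinP; exact: continuous_measurable_fun.
- move=> x _ /=; rewrite lee_fin; apply: le_trans (HC x) _.
  by rewrite ler_norm.
Qed.

Let is_derive_phi (x : R) : is_derive x 1 phi (- x * phi x).
Proof.
rewrite (_ : phi = fun x => normal_peak 1 *: expR (- (2^-1 *: (x ^+ 2 : R^o)))); last first.
  by apply/funext => y; rewrite phiE /GRing.scale /= [_ / 2]mulrC.
apply: is_derive_eq.
by rewrite /GRing.scale /=; field.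
Qed.

(** The integrand is the derivative of [- q * phi]. It is integrated over growing intervals;
    dominated convergence handles the integrals and the boundary terms tend to 0. *)
Lemma integral_gaussian_ibp (q : {poly R}) :
  (\int[mu]_x (('X * q - q^`()).[x] * phi x)%:E = 0)%E.
Proof.
set r : {poly R} := 'X * q - q^`().
pose F x := - (q.[x] * phi x).
have dF (x : R) : is_derive x 1 F (r.[x] * phi x).
  apply: (is_derive_eq (is_deriveN (is_deriveM (is_derive_poly q x) (is_derive_phi x)))).
  have -> : r.[x] = x * q.[x] - q^`().[x] by rewrite /r hornerD hornerN hornerM hornerX.
  by rewrite /GRing.scale /=; move: q.[x] q^`().[x] (phi x) => a b c; ring.
(* [k.+1] keeps the interval nondegenerate at k = 0. *)
pose A k : set R := `[- k.+1%:R, k.+1%:R]%classic.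
pose f_ k x : \bar R := ((fun x => (r.[x] * phi x)%:E) \_ (A k)) x.
have [C [C0 HC]] := poly_pdf_bound r.
(* The extra factor ['X] gives [F] a decay of order 1/|x| at the endpoints. *)
have [K [K0 HK]] := poly_pdf_bound ('X * q).
have fcvg : (\int[mu]_x f_ k x @[k --> \oo] --> \int[mu]_x (r.[x] * phi x)%:E)%E.
  apply: (@dominated_cvg _ _ _ mu setT measurableT f_ _
    (fun x => (C * normal_pdf 0 2 x)%:E)) => //.
  - move=> k; apply/(measurable_restrictT _ _).1; first exact: measurable_itv.
    apply: measurable_funTS; apply/measurable_EFinP; exact: continuous_measurable_fun.
  - move=> x _; apply: cvg_near_cst; near=> k.
    suff xA : A k x by rewrite /f_ patchE mem_set.
    rewrite /A /= in_itv /= -ler_norml.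
    apply: (@le_trans _ _ k%:R); last by rewrite ler_nat.
    by near: k; exact: nbhs_infty_ger.
  - under eq_fun do rewrite EFinM.
    by apply: integrableZl => //; exact: integrable_normal_pdf.
  - move=> k x _; rewrite /f_ patchE; case: ifP => _.
      by rewrite lee_fin; exact: HC.
    by rewrite abse0 lee_fin mulr_ge0// normal_pdf_ge0.
have fE k : (\int[mu]_x f_ k x = (F k.+1%:R - F (- k.+1%:R))%:E)%E.
  rewrite /f_ -integral_mkcond EFinB.
  apply: (@continuous_FTC2 _ (fun x => r.[x] * phi x)).
  - by rewrite gtrN.
  - by apply: continuous_subspaceT; exact: cqphi.
  - split=> [x _||]; first by case: (dF x).
      by apply: cvg_at_right_filter; apply: cvgN; exact: cqphi.
    by apply: cvg_at_left_filter; apply: cvgN; exact: cqphi.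
  - by move=> x _; rewrite derive1E; case: (dF x).
have Fb (x : R) : x != 0 -> `|F x| <= K * normal_peak 2 / `|x|.
  move=> x0; rewrite ler_pdivlMr ?normr_gt0// /F normrN -normrM mulrC mulrA.
  have := HK x; rewrite hornerM hornerX => /le_trans; apply.
  by rewrite ler_wpM2l// normal_pdf_ub// pnatr_eq0.
have F0 : (F k.+1%:R - F (- k.+1%:R))%:E @[k --> \oo] --> 0%E.
  apply: cvg_EFin; first exact: nearW.
  apply/cvgr0Pnorm_le => e e0.
  have : (2 * (K * normal_peak 2)) *: (harmonic k : R^o) @[k --> \oo] --> (0 : R^o).
    by rewrite -(scaler0 _ (2 * (K * normal_peak 2))); apply: cvgZr; exact: cvg_harmonic.
  move/cvgr0Pnorm_le => /(_ e e0); apply: filterS => k /=.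
  apply: le_trans; apply: le_trans (ler_normB _ _) _.
  have -> : 2 * (K * normal_peak 2) *: k.+1%:R^-1 =
    K * normal_peak 2 / `|k.+1%:R| + K * normal_peak 2 / `|- k.+1%:R| :> R.
    by rewrite normrN ger0_norm// /GRing.scale /=; ring.
  rewrite [leRHS]ger0_norm; last by rewrite addr_ge0// divr_ge0// mulr_ge0// normal_peak_ge0.
  by rewrite lerD// Fb// ?oppr_eq0 pnatr_eq0.
have fFE : (fun k => \int[mu]_x f_ k x)%E = (fun k => (F k.+1%:R - F (- k.+1%:R))%:E).
  by apply/funext.
rewrite fFE in fcvg.
exact: (cvg_unique _ fcvg F0).
Unshelve. all: by end_near. Qed.

End gaussian_moments.

(** * The standard normal law as a probability on the real line *)

Section std_normal.
Variable R : realType.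

(* [normal_prob] lives on the sigma-algebra type generated by intervals; this is
   the same set function on [R] with its canonical measurable structure. *)
Definition std_normal (A : set R) : \bar R := normal_prob (0 : R) 1 A.

Let std_normal0 : std_normal set0 = 0%E.
Proof. exact: (measure0 (normal_prob (0 : R) 1)). Qed.

Let std_normal_ge0 A : (0 <= std_normal A)%E.
Proof. exact: (measure_ge0 (normal_prob (0 : R) 1)). Qed.

Let std_normal_sigma_additive : semi_sigma_additive std_normal.
Proof. exact: (@measure_semi_sigma_additive _ _ _ (normal_prob (0 : R) 1)). Qed.

HB.instance Definition _ := isMeasure.Build _ R R std_normal
  std_normal0 std_normal_ge0 std_normal_sigma_additive.

Let std_normal_setT : std_normal setT = 1%E.
Proof. exact: (@probability_setT _ _ _ (normal_prob (0 : R) 1)). Qed.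

HB.instance Definition _ := Measure_isProbability.Build _ R R std_normal std_normal_setT.

End std_normal.

(** * Hermite polynomials and their Gaussian means *)

Section hermite_mean.
Variable R : realType.
Local Notation mu := (@lebesgue_measure R).
Local Notation phi := (normal_pdf (0 : R) 1).

(** The weighted law for the identity map, with the density as weight. *)
Lemma integral_std_normal_ge0 (f : R -> R) : measurable_fun setT f -> (forall x, 0 <= f x) ->
  (\int[@std_normal R]_x (f x)%:E = \int[mu]_x (f x * phi x)%:E)%E.
Proof.
move=> mf f0.
have := @ge0_integral_weighted_law _ _ _ _ R mu (@std_normal R) id phi 1 f.
rewrite mul1e => <- //.
- by apply: eq_integral => x _; rewrite mulrC.
- exact: measurable_normal_pdf.
- by move=> x; exact: normal_pdf_ge0.
move=> A mA; rewrite mul1e /std_normal /normal_prob [RHS]integral_mkcond.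
apply: eq_integral => x _; rewrite patchE indicE.
by case: ifP => xA; rewrite ?mulr1 ?mulr0.
Qed.

Lemma integrable_poly_normal (q : {poly R}) :
  (@std_normal R).-integrable setT (fun x : R => (q.[x])%:E).
Proof.
have mq : measurable_fun setT (horner q).
  by apply: continuous_measurable_fun; exact: continuous_horner.
apply/integrableP; split; first exact/measurable_EFinP.
rewrite integral_std_normal_ge0//; last exact: measurableT_comp.
have /integrableP[_] := integrable_poly_pdf q.
under eq_integral do rewrite /= normrM (ger0_norm (normal_pdf_ge0 _ _ _)).
by [].
Qed.

Lemma polymean_normalE (q : {poly R}) :
  polymean (@std_normal R) q = fine (\int[mu]_x (q.[x] * phi x)%:E)%E.
Proof.
rewrite {1 2}(poly_diff_squares q); set q1 : {poly R} := (_ *: (q + 1)) ^+ 2; set q2 : {poly R} := (_ *: (q - 1)) ^+ 2.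
have mq (p : {poly R}) : measurable_fun setT (horner p).
  by apply: continuous_measurable_fun; exact: continuous_horner.
rewrite (polymeanB (nu := @std_normal R) integrable_poly_normal).
rewrite /polymean !integral_std_normal_ge0//; last 2 first.
- by move=> x; rewrite horner_exp sqr_ge0.
- by move=> x; rewrite horner_exp sqr_ge0.
rewrite -fineB; last 2 first.
- by apply: integrable_fin_num => //; exact: integrable_poly_pdf.
- by apply: integrable_fin_num => //; exact: integrable_poly_pdf.
rewrite -integralB//; last 2 first.
- exact: integrable_poly_pdf.
- exact: integrable_poly_pdf.
by congr fine; apply: eq_integral => x _; rewrite hornerD hornerN mulrBl EFinB.
Qed.

(** The probabilists' Hermite polynomials, in the form to which Gaussian integration by parts
    applies: mean zero in positive degree is immediate. *)
Fixpoint hermite k : {poly R} :=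
  if k is k'.+1 then 'X * hermite k' - (hermite k')^`() else 1.

Lemma deriv_hermite k : (hermite k)^`() = k%:R *: hermite k.-1.
Proof.
elim: k => [|k IH]; first by rewrite /= scale0r derivC.
rewrite /= derivB derivM derivX mul1r IH derivZ -natr1 scalerDl scale1r.
rewrite -addrA [RHS]addrC; congr (_ + _).
case: k IH => [|k] _; first by rewrite !scale0r mulr0 subrr.
by rewrite /= -scalerAr -scalerBr.
Qed.

Lemma hermite_rec k : 'X * hermite k = hermite k.+1 + k%:R *: hermite k.-1.
Proof. by rewrite /= deriv_hermite subrK. Qed.

Lemma polymean_hermite k : polymean (@std_normal R) (hermite k) = (k == 0)%:R.
Proof.
case: k => [|k]; last by rewrite polymean_normalE /= integral_gaussian_ibp.
rewrite /polymean; under eq_integral do rewrite hornerC.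
by rewrite integral_cst//= probability_setT mule1.
Qed.

End hermite_mean.

(** * Expected traces *)

Section expected_trace.
Context (R : realType) (d : measure_display) (T : measurableType d).
Variables (P : probability T R) (n : nat).
Variables (b : 'I_n -> 'I_n -> R) (g : 'I_n -> 'I_n -> T -> R).
Hypothesis hg : iid_std_gaussian P g.
Implicit Types (m : {ffun 'I_n * 'I_n -> nat}) (e : 'I_n * 'I_n).

Let D : pred ('I_n * 'I_n) := fun e => (e.2 <= e.1)%N.
Let X e w : R := g e.1 e.2 w.
Let bE e : R := b e.1 e.2.

Let D_edge v w : D (edge v w).
Proof. by rewrite /D /edge; case: ifP => //= /negbT; rewrite -ltnNge => /ltnW. Qed.

Let symextE {U : Type} (f : 'I_n -> 'I_n -> U) v w :
  symext f v w = f (edge v w).1 (edge v w).2.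
Proof. by rewrite /symext /edge; case: ifP. Qed.

Let mX e : D e -> measurable_fun setT (X e).
Proof. by move=> De; case: hg => H _ _; exact: H. Qed.

Let indepX (A : 'I_n * 'I_n -> set R) : (forall e, measurable (A e)) ->
  P [set w | forall e, D e -> A e (X e w)] = (\prod_(e | D e) std_normal (A e))%E.
Proof.
move=> mA; case: hg => _ law indep.
rewrite (_ : [set w | _] =
  [set w | forall i j : 'I_n, (j <= i)%N -> A (i, j) (g i j w)]); last first.
  by apply/seteqP; split => w /= H; [move=> i j; exact: (H (i, j))|case=> i j; exact: H].
rewrite (indep (fun i j => A (i, j))) // pair_big_dep /=.
by apply: eq_bigr => -[i j] /= ij; rewrite law.
Qed.

Definition hprod m w : R := \prod_(e | D e) (hermite R (m e)).[X e w].
(** The factors [b] that closing the copies in [m] will collect. With these taken out, an opening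
    carries [b ^+ 2] and a closing carries no [b]. *)
Definition bprod m : R := \prod_(e | D e) bE e ^+ m e.

Lemma hprod_mul m e w : D e ->
  X e w * hprod m w = hprod (incm e m) w + (m e)%:R * hprod (decm e m) w.
Proof.
move=> De; rewrite /hprod (bigD1 e)//= [in RHS](bigD1 e)//= !ffunE eqxx addn1.
rewrite [X in _ + _ * X](bigD1 e)//= !ffunE eqxx subn1.
have -> : \prod_(i | D i && (i != e)) (hermite R (incm e m i)).[X i w] =
  \prod_(i | D i && (i != e)) (hermite R (m i)).[X i w].
  by apply: eq_bigr => i /andP[_ /negbTE ie]; rewrite ffunE ie addn0.
have -> : \prod_(i | D i && (i != e)) (hermite R (decm e m i)).[X i w] =
  \prod_(i | D i && (i != e)) (hermite R (m i)).[X i w].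
  by apply: eq_bigr => i /andP[_ /negbTE ie]; rewrite ffunE ie subn0.
have := congr1 (fun q => q.[X e w]) (hermite_rec R (m e)).
rewrite hornerD hornerZ hornerM hornerX => H.
by rewrite mulrA H mulrDl -mulrA.
Qed.

Lemma bprod_inc m e : D e -> bprod (incm e m) = bE e * bprod m.
Proof.
move=> De; rewrite /bprod (bigD1 e)//= [in RHS](bigD1 e)//= !ffunE eqxx addn1 exprS.
rewrite -mulrA; congr (_ * (_ * _)).
by apply: eq_bigr => i /andP[_ /negbTE ie]; rewrite ffunE ie addn0.
Qed.

Lemma bprod_dec m e : D e -> (m e)%:R * (bE e * bprod (decm e m)) = (m e)%:R * bprod m.
Proof.
move=> De; have [->|me] := posnP (m e); first by rewrite !mul0r.
by rewrite -bprod_inc // decmK.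
Qed.

(** [hprod] sees only the lower triangle, while the test [m == 0] sees all entries; on canonical [m]
    the two agree. *)
Let canonical m := forall e, ~~ D e -> m e = 0%N.

Let canonical_inc m v w : canonical m -> canonical (incm (edge v w) m).
Proof.
move=> cm e De; rewrite ffunE cm// add0n.
by case: eqP De => // ->; rewrite D_edge.
Qed.

Let canonical_dec m v w : canonical m -> canonical (decm (edge v w) m).
Proof. by move=> cm e De; rewrite ffunE cm. Qed.

Lemma integral_hprod m : canonical m ->
  P.-integrable setT (fun w => (hprod m w)%:E) /\
  (\int[P]_w (hprod m w)%:E = (bprod m * (m == [ffun=> 0%N])%:R)%:E)%E.
Proof.
move=> cm.
have [iH eH] := @integral_prod_poly _ _ R _ P (@std_normal R) D X mX indepX
  (@integrable_poly_normal R) (fun e => hermite R (m e)).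
split=> //; rewrite eH; congr EFin; under eq_bigr do rewrite polymean_hermite.
have [->|m0] := eqVneq m [ffun=> 0%N].
  by rewrite mulr1 /bprod !big1// => e _; rewrite ffunE.
have /existsP[e me] : [exists e, m e != 0%N].
  apply: contraR m0; rewrite negb_exists => /forallP m0.
  by apply/eqP/ffunP => e; rewrite ffunE; apply/eqP; rewrite -[_ == _]negbK.
have De : D e by apply: contraR me => /cm ->.
by rewrite mulr0 (bigD1 e)//= (negbTE me) mul0r.
Qed.

(** Induction on [t]: the first factor of the matrix power is split off, and its Gaussian variable
    is absorbed into [hprod] by the Hermite recurrence, giving one opening and one closing term. *)
Lemma integral_wick u t m v : canonical m ->
  P.-integrable setT (fun w => ((randmx b g w ^+ t) v u * hprod m w)%:E) /\
  (\int[P]_w ((randmx b g w ^+ t) v u * hprod m w)%:E =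
    (bprod m * wick (fun v w => symext b v w ^+ 2) u t m v)%:E)%E.
Proof.
elim: t m v => [|t IH] m v cm.
  have [iH eH] := integral_hprod cm.
  rewrite (_ : (fun w => _) = (fun w => ((v == u)%:R%:E * (hprod m w)%:E)%E)); last first.
    by apply/funext => w; rewrite expr0 mxE EFinM.
  split; first exact: integrableZl.
  by rewrite integralZl// eH -EFinM /= mulrCA -natrM mulnb.
pose e w' := edge v w'.
pose F k w' w := (((randmx b g w ^+ t) w' u) * hprod (k (e w') m) w)%:E.
have Finc w' := IH (incm (e w') m) w' (canonical_inc v w' cm).
have Fdec w' := IH (decm (e w') m) w' (canonical_dec v w' cm).
have -> : (fun w => ((randmx b g w ^+ t.+1) v u * hprod m w)%:E) =
  (fun w => \sum_w' ((bE (e w'))%:E * F (@incm n) w' w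
                 + (bE (e w') * (m (e w'))%:R)%:E * F (@decm n) w' w))%E.
  apply/funext => w; rewrite exprS mxE mulr_suml -sumEFin; apply: eq_bigr => w' _.
  rewrite /F -!EFinM -EFinD; congr EFin.
  rewrite mxE !symextE -/(bE _) -/(X _ w) -/(e w') -mulrA -mulrA mulrCA.
  have := hprod_mul m w (D_edge v w'); rewrite -/(e w').
  move: (X _ w) (hprod _ w) (hprod _ w) (hprod _ w) => x h1 h2 h3 H.
  transitivity (bE (e w') * (randmx b g w ^+ t) w' u * (x * h3)); first by ring.
  by rewrite H; ring.
have iF w' : P.-integrable setT (fun w => ((bE (e w'))%:E * F (@incm n) w' w
                 + (bE (e w') * (m (e w'))%:R)%:E * F (@decm n) w' w)%E).
  by apply: integrableD => //; apply: integrableZl => //; [exact: (Finc _).1|exact: (Fdec _).1].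
split; first exact: integrable_sum.
rewrite integral_sum//= mulr_sumr -sumEFin; apply: eq_bigr => w' _.
rewrite integralD//; last 2 first.
- by apply: integrableZl => //; exact: (Finc _).1.
- by apply: integrableZl => //; exact: (Fdec _).1.
rewrite !integralZl//; last 2 first.
- exact: (Fdec _).1.
- exact: (Finc _).1.
rewrite (Finc w').2 (Fdec w').2 -!EFinM -EFinD; congr EFin.
rewrite bprod_inc ?D_edge// symextE -/(bE _) -/(e w').
rewrite mulrDr [bE (e w') * (m _)%:R]mulrC -!mulrA [bE _ * (bprod (decm _ _) * _)]mulrA mulrA.
rewrite [(m _)%:R * (_ * _ * _)]mulrA bprod_dec ?D_edge//.
by congr (_ + _); rewrite ?expr2; ring.
Qed.

Lemma integral_trace t :
  P.-integrable setT (fun w => (\tr (randmx b g w ^+ t))%:E) /\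
  (\int[P]_w (\tr (randmx b g w ^+ t))%:E =
   (\sum_u wick (fun v w => symext b v w ^+ 2) u t [ffun=> 0%N] u)%:E)%E.
Proof.
have h0 w : hprod [ffun=> 0%N] w = 1.
  by rewrite /hprod big1// => e _; rewrite ffunE hornerC.
have b0 : bprod [ffun=> 0%N] = 1 by rewrite /bprod big1// => e _; rewrite ffunE.
have c0 : canonical [ffun=> 0%N] by move=> e _; rewrite ffunE.
have iE u := integral_wick u t u c0.
have -> : (fun w => (\tr (randmx b g w ^+ t))%:E) =
  (fun w => \sum_u ((randmx b g w ^+ t) u u * hprod [ffun=> 0%N] w)%:E)%E.
  apply/funext => w; rewrite /mxtrace -sumEFin; apply: eq_bigr => u _.
  by rewrite h0 mulr1.
split; first by apply: integrable_sum => // u _; exact: (iE u).1.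
rewrite integral_sum//; last by move=> u; exact: (iE u).1.
by rewrite -sumEFin; apply: eq_bigr => u _; rewrite (iE u).2 b0 mul1r.
Qed.

End expected_trace.

(** * Expected operator norm *)

(** The integral is a supremum over simple functions below the integrand. It allows the operator
    norm to be compared with the trace pointwise, without a measurability proof for the norm. *)
Lemma ge0_le_integral_nonmeasurable d (T : measurableType d) (R : realType)
    (mu : {measure set T -> \bar R}) (f h : T -> \bar R) :
  (forall x, 0 <= f x)%E -> (forall x, f x <= h x)%E ->
  (\int[mu]_x f x <= \int[mu]_x h x)%E.
Proof.
move=> f0 fh; have h0 x : (0 <= h x)%E by apply: le_trans (fh x).
rewrite !ge0_integralTE//; apply: ge_ereal_sup => _ [s /= sf <-].
by apply: ereal_sup_ubound; exists s => // x; apply: le_trans (fh x).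
Qed.

Section expected_opnorm.
Context (R : realType) (d : measure_display) (T : measurableType d).
Variables (P : probability T R) (n : nat).
Variables (b : 'I_n -> 'I_n -> R) (g : 'I_n -> 'I_n -> T -> R).
Hypotheses (n_gt0 : (0 < n)%N) (hg : iid_std_gaussian P g).

Lemma randmx_sym w : (randmx b g w)^T = randmx b g w.
Proof.
apply/matrixP => i j; rewrite !mxE /symext.
by case: (ltngtP i j) => // ij; rewrite (val_inj ij).
Qed.

(** The tangent bound is affine in the trace, with slope [k] and intercept [c], so it can be
    integrated directly; no Jensen inequality or 2p-th root is taken. *)
Lemma expected_opnorm_le p (a : R) : (0 < p)%N -> 0 < a ->
  \sum_u wick (fun v w => symext b v w ^+ 2) u (p + p) [ffun=> 0%N] u <= a ^+ (p + p) ->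
  ('E_P[fun w => opnorm (randmx b g w)] <= a%:E)%E.
Proof.
move=> p0 a0; set K := (\sum_u _) => Ka.
have [iT eT] := integral_trace b hg (p + p).
have q0 : 0 < (p + p)%:R :> R by rewrite ltr0n addn_gt0 p0.
pose k := a / (p + p)%:R / a ^+ (p + p).
have k0 : 0 <= k by rewrite !divr_ge0// ?exprn_ge0 ?ltW.
pose c := a - a / (p + p)%:R.
rewrite unlock; apply: (@le_trans _ _ (\int[P]_w
   (k%:E * (\tr (randmx b g w ^+ (p + p)))%:E + c%:E))%E).
  apply: ge0_le_integral_nonmeasurable => w; first by rewrite lee_fin opnorm_ge0.
  rewrite -EFinM -EFinD lee_fin.
  have := opnorm_le_trace n_gt0 p0 a0 (randmx_sym w).
  by move=> /le_trans; apply; rewrite /k /c le_eqVlt; apply/orP; left; apply/eqP; ring.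
rewrite integralD//; last 2 first.
- exact: integrableZl.
- exact: finite_measure_integrable_cst.
rewrite integralZl// eT integral_cst//= probability_setT mule1 -EFinM -EFinD lee_fin.
have : k * K <= a / (p + p)%:R.
  by rewrite /k mulrAC ler_pdivrMr ?exprn_gt0// ler_wpM2l// divr_ge0// ltW.
by rewrite -/K /c; move: (k * K) (a / _) => x y; lra.
Qed.

(** [wick_le] from the state with nothing open, where the potential is 1, for walks of length N =
    2p; hence the constant 4p. *)
Lemma wick_sum_le p (c : R) : 0 < c ->
  sigma_row b ^+ 2 + 4 * p%:R * sigma_star b ^+ 2 <= c ^+ 2 ->
  \sum_u wick (fun v w => symext b v w ^+ 2) u (p + p) [ffun=> 0%N] u
    <= n%:R * (2 * c) ^+ (p + p).
Proof.
move=> c0 Hc.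
have ned0 : nedges ([ffun=> 0%N] : {ffun 'I_n * 'I_n -> nat}) = 0%N.
  by rewrite /nedges big1// => e _; rewrite ffunE.
have pot0 (u : 'I_n) : potential [ffun=> 0%N] u = 1%N.
  rewrite /potential big1// => x _; rewrite /pdeg /deg big1 ?add0n; last first.
    by move=> e _; rewrite ffunE.
  by case: (x == u).
have -> : n%:R * (2 * c) ^+ (p + p) = \sum_(u < n) (2 * c) ^+ (p + p).
  by rewrite sumr_const card_ord mulr_natl.
apply: ler_sum => u _.
have := @wick_le R n (fun v w => symext b v w ^+ 2) u (p + p)
  (sigma_row b ^+ 2) (sigma_star b ^+ 2) c (p + p) [ffun=> 0%N] u.
rewrite ned0 pot0 expr0 !mulr1; apply=> //.
- by move=> v w; rewrite sqr_ge0.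
- move=> v w; rewrite -real_normK ?num_real// lerXn2r ?nnegrE//.
    exact: bigmax_ge_id.
  by apply: le_trans (le_bigmax _ _ v); exact: le_bigmax.
- move=> v; have s0 : 0 <= \sum_w symext b v w ^+ 2.
    by apply: sumr_ge0 => w _; rewrite sqr_ge0.
  rewrite -[leLHS]sqr_sqrtr// lerXn2r ?nnegrE ?sqrtr_ge0//.
    exact: bigmax_ge_id.
  exact: le_bigmax.
- by apply: le_trans Hc; rewrite addnn -!muln2 !natrM; lra.
Qed.

End expected_opnorm.

(** * Dimension one and the final choice of parameters *)

(** The only contributing walk opens the loop and closes it again. *)
Lemma wick_dim1 (R : realType) (B : 'I_1 -> 'I_1 -> R) u :
  wick B u 2 [ffun=> 0%N] u = B u u.
Proof.
rewrite /= !big_ord1 !ffunE !ord1 !eqxx /= mul0r addr0 mul1r.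
set e := edge _ _; set m2 := incm _ _.
have -> : (m2 == [ffun=> 0%N]) = false.
  by apply/negbTE/eqP => /ffunP /(_ e); rewrite !ffunE eqxx addn1.
set m0 := decm _ _.
have -> : m0 == [ffun=> 0%N] by apply/eqP/ffunP => f; rewrite !ffunE add0n subnn.
by rewrite mulr0 add0r mulr1.
Qed.

Theorem theorem1p1 (R : realType) (d : measure_display) (T : measurableType d)
  (P : probability T R) (n : nat) (hn : (1 <= n)%N)
  (b : 'I_n -> 'I_n -> R) (g : 'I_n -> 'I_n -> T -> R)
  (hg : iid_std_gaussian P g) (eps : R) (heps0 : 0 < eps) (heps1 : eps <= 1 / 2) :
  ('E_P[fun w => opnorm (randmx b g w)] <=
   ((1 + eps) * (2 * sigma_row b
       + 6 / Num.sqrt (ln (1 + eps)) * sigma_star b * Num.sqrt (ln n%:R)))%:E)%E.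
Proof.
have s0 : 0 <= sigma_row b by exact: bigmax_ge_id.
have ss0 : 0 <= sigma_star b by exact: bigmax_ge_id.
have eps1 : 0 < 1 + eps by rewrite addr_gt0.
set l := ln (1 + eps).
have l0 : 0 < l by rewrite ln_gt0// ltrDl.
(* The slack [e] keeps [a] and [c] strictly positive even when every [b] vanishes. *)
apply/lee_addgt0Pr => e e0; rewrite -EFinD.
(* For n = 1 the logarithm vanishes and no [sigma_star] term is available; the second moment alone
   (p = 1) gives the bound. *)
have [n1|n1] := leqP n 1.
  have nE : n = 1%N by apply/eqP; rewrite eqn_leq n1.
  rewrite nE in b g hg s0 ss0 *.
  apply: (expected_opnorm_le _ hg (p := 1)) => //.
    by rewrite ltr_wpDl// mulr_ge0 ?(ltW eps1)// addr_ge0 ?mulr_ge0 ?sqrtr_ge0 ?invr_ge0 ?sqrtr_ge0.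
  rewrite big_ord1 wick_dim1.
  have bs : symext b ord0 ord0 ^+ 2 <= sigma_row b ^+ 2.
    rewrite -[leLHS]sqr_sqrtr ?sqr_ge0// lerXn2r ?nnegrE ?sqrtr_ge0//.
    by apply: le_trans (le_bigmax _ _ ord0); rewrite big_ord1.
  apply: le_trans bs _; rewrite lerXn2r ?nnegrE//.
    by rewrite addr_ge0 ?(ltW e0)// mulr_ge0 ?(ltW eps1)// addr_ge0 ?mulr_ge0 ?sqrtr_ge0 ?invr_ge0 ?sqrtr_ge0.
  rewrite ln1 sqrtr0 mulr0 addr0; nra.
(* The exponent with (1 + eps)^(2L) = n. *)
set L := ln n%:R / (2 * l).
have n0 : 0 < n%:R :> R by rewrite ltr0n.
(* Here [eps <= 1 / 2] enters: 1 + eps <= 2 <= n. *)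
have L12 : 1 / 2 <= L.
  rewrite /L ler_pdivlMr ?mulr_gt0// mulrA divfK ?pnatr_eq0// mul1r ler_ln ?posrE//.
  apply: (@le_trans _ _ 2); last by rewrite ler_nat.
  by lra.
pose p := (Num.truncn L).+1.
have Lp : L <= p%:R by apply/ltW/truncnS_gt.
(* If L < 1 then p = 1 <= 2L by the previous bound; otherwise p <= L + 1 <= 2L. *)
have p2L : p%:R <= 2 * L.
  rewrite /p -natr1; have [L1|L1] := ltP L 1.
    have -> : Num.truncn L = 0%N by apply/eqP; rewrite -leqn0 truncn_le_nat.
    by lra.
  have : (Num.truncn L)%:R <= L by rewrite truncn_le; lra.
  by lra.
(* Chosen with r^2 = 4p, so that the square of sigma + r sigma_* dominates sigma^2 + 4p
   sigma_*^2. *)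
pose r : R := 2 * Num.sqrt p%:R.
have r0 : 0 <= r by rewrite mulr_ge0 ?sqrtr_ge0.
(* After multiplication by 2(1 + eps) the last term becomes exactly [e]. *)
pose c := sigma_row b + r * sigma_star b + e / (2 * (1 + eps)).
have ee0 : 0 < e / (2 * (1 + eps)) by rewrite divr_gt0// mulr_gt0.
have c0 : 0 < c by rewrite ltr_wpDl// addr_ge0// mulr_ge0.
have cle : sigma_row b ^+ 2 + 4 * p%:R * sigma_star b ^+ 2 <= c ^+ 2.
  apply: (@le_trans _ _ ((sigma_row b + r * sigma_star b) ^+ 2)); last first.
    by rewrite lerXn2r ?nnegrE ?(ltW c0) ?addr_ge0 ?mulr_ge0// /c lerDl ltW.
  have -> : 4 * p%:R = r ^+ 2 by rewrite exprMn sqr_sqrtr// -natrX.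
  have rs0 : 0 <= r * sigma_star b by rewrite mulr_ge0.
  by rewrite -exprMn; move: (r * _) rs0 => z z0; nra.
have npow : n%:R <= (1 + eps) ^+ (p + p).
  rewrite -ler_ln ?posrE ?exprn_gt0// lnXn// -/l -[leRHS]mulr_natl.
  have -> : ln n%:R = 2 * L * l by rewrite /L; field; rewrite gt_eqF.
  by rewrite ler_pM2r// natrD; lra.
have a0 : 0 < (1 + eps) * (2 * c) by rewrite !mulr_gt0.
apply: le_trans (expected_opnorm_le hn hg (p := p) (ltn0Sn _) a0 _) _.
  apply: le_trans (wick_sum_le c0 cle) _.
  by rewrite [leRHS]exprMn ler_wpM2r ?exprn_ge0// mulr_ge0// ltW.
rewrite lee_fin /c.
have -> : (1 + eps) * (2 * (sigma_row b + r * sigma_star b + e / (2 * (1 + eps)))) =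
  (1 + eps) * (2 * sigma_row b + 2 * r * sigma_star b) + e.
  by field; rewrite gt_eqF.
rewrite lerD2r ler_pM2l// lerD2l [leRHS]mulrAC ler_wpM2r//.
(* It remains to see that 2r = 4 sqrt p is at most 6 sqrt(2L), which follows from p <= 2L and 4 <=
   6. *)
have -> : 6 / Num.sqrt l * Num.sqrt (ln n%:R) = 6 * Num.sqrt (2 * L).
  rewrite -mulrA [X in 6 * X]mulrC -sqrtrV ?(ltW l0)// -sqrtrM; last first.
    by rewrite ln_ge0// ler1n.
  by congr (_ * Num.sqrt _); rewrite /L; field; rewrite gt_eqF.
have spL : Num.sqrt p%:R <= Num.sqrt (2 * L) by rewrite ler_wsqrtr.
apply: (@le_trans _ _ (6 * Num.sqrt p%:R)); last by rewrite ler_wpM2l.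
by rewrite /r mulrA ler_wpM2r ?sqrtr_ge0// -natrM ler_nat.
Qed.
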